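(* Let $T:\mathbb{E}\rightrightarrows\mathbb{E}$ be a set-valued mapping with $\operatorname{Fix}T$ nonempty, let $\Lambda\subset\mathbb{E}$ be such that $\operatorname{Fix}T\cap\Lambda$ is closed and nonempty, let $\Omega\subset\Lambda$, and let $c\in[0,1)$. Suppose that for each $x_0\in\Omega$, every sequence $(x_k)_{k\in\mathbb{N}}$ generated from $x_0$ by $x_{k+1}\in Tx_k$ satisfies $Tx_k\subset\Lambda$ for all $k\in\mathbb{N}$ and is linearly monotone with respect to $\operatorname{Fix}T\cap\Lambda$ with constant $c$. Then the mapping $\Phi:=T-\mathrm{Id}$ is metrically subregular on $\Omega$ for $0$ relative to $\Lambda$ with a constant $\kappa\le\frac{1}{1-c}$.
   Context: $\mathbb{E}$ is a Euclidean space; $\operatorname{dist}(x,C):=\inf_{a\in C}\|x-a\|$ (equal to $+\infty$ if $C=\emptyset$). A set-valued mapping $T:\mathbb{E}\rightrightarrows\mathbb{E}$ assigns to each $x\in\mathbb{E}$ a nonempty subset $Tx\subset\mathbb{E}$. $\operatorname{Fix}T:=\{x\in\mathbb{E}: x\in Tx\}$. $\Phi=T-\mathrm{Id}$ means $\Phi(x)=\{x^+-x: x^+\in Tx\}$, and $\Phi^{-1}(y)=\{x: y\in\Phi(x)\}$. The set $\Lambda$ is closed and nonempty. Linear monotonicity: a sequence $(x_k)$ is linearly monotone with respect to a nonempty set $S$ with constant $c\in[0,1]$ if $\operatorname{dist}(x_{k+1},S)\le c\,\operatorname{dist}(x_k,S)$ for all $k\in\mathbb{N}$. Metric subregularity: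 $\Phi$ is metrically subregular on $U\subset\mathbb{E}$ for $y$ relative to $\Lambda$ with constant $\kappa$ if $\operatorname{dist}(x,\Phi^{-1}(y)\cap\Lambda)\le\kappa\operatorname{dist}(y,\Phi(x))$ for all $x\in U\cap\Lambda$. *)

(* Defs.v *)
From HB Require Import structures.
From mathcomp Require Import all_boot all_order all_algebra.
From mathcomp Require Import all_classical all_reals all_analysis.
Import numFieldNormedType.Exports.

Set Implicit Arguments.
Unset Strict Implicit.
Unset Printing Implicit Defensive.

Import Order.TTheory GRing.Theory Num.Theory.

Local Open Scope classical_set_scope.
Local Open Scope ring_scope.

(* The norm, and hence the topology, is the one carried by the normed module;
   [sqr_normE] forces it to be the norm of the inner product. *)
HB.mixin Record NormedModule_isEuclidean (R : realType) E
    of NormedModule R E & Vector R E := {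
  inner : {dot E for idfun} ;
  sqr_normE : forall x : E, `|x| ^+ 2 = inner x x
}.

#[short(type="euclideanType")]
HB.structure Definition Euclidean (R : realType) :=
  { E of NormedModule R E & Vector R E & NormedModule_isEuclidean R E }.

Section Definitions.
Context {R : realType} {E : euclideanType R}.
Implicit Types (T Phi : E -> set E) (S C U L : set E) (x y : E).

(* Extended-real valued, so that [dist x set0 = +oo]. *)
Definition dist x C : \bar R := ereal_inf [set `|x - a|%:E | a in C].

Definition Fix T : set E := [set x | T x x].

Definition minus_id T : E -> set E := fun x => [set xp - x | xp in T x].

Definition inv_image Phi y : set E := [set x | Phi x y].

Definition generated_by T (u : nat -> E) : Prop :=
  forall k, T (u k) (u k.+1).

Definition linearly_monotone (u : nat -> E) S (c : R) : Prop :=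
  forall k, (dist (u k.+1) S <= c%:E * dist (u k) S)%E.

Definition metrically_subregular Phi U y L (kappa : R) : Prop :=
  forall x, (U `&` L) x ->
    (dist x (inv_image Phi y `&` L) <= kappa%:E * dist y (Phi x))%E.

End Definitions.

(* Main.v *)
Require Import Defs.
From mathcomp Require Import all_boot all_order all_algebra.
From mathcomp Require Import all_classical all_reals all_analysis.
Import numFieldNormedType.Exports.
Import Order.TTheory GRing.Theory Num.Theory.

(** Only the first step of a sequence matters.  Put [S := Fix T `&` Lambda],
    and take [x] in [Omega] and [y] in [T x].  Since [T] has nonempty values,
    [x, y] extends to a sequence generated by [T], so monotonicity at its first
    step gives [dist y S <= c * dist x S].  With the triangle inequality
    ([le_dist_normD]),
      [dist x S <= `|x - y| + dist y S <= `|x - y| + c * dist x S],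
    and [dist x S] is finite because [S] is nonempty; hence
    [(1 - c) * dist x S <= `|x - y|].  The infimum over [y] in [T x] of the
    right-hand side is [dist 0 (minus_id T x)], while [S] is the zero set of
    [minus_id T] within [Lambda], so [(1 - c)^-1] is a constant of
    subregularity. *)

Local Open Scope classical_set_scope.
Local Open Scope ring_scope.

Section Distance.
Context {R : realType} {E : euclideanType R}.
Implicit Types (S : set E) (x y a : E).

Lemma dist_le_norm x S a : S a -> (dist x S <= `|x - a|%:E)%E.
Proof. by move=> Sa; apply: ereal_inf_lbound; exists a. Qed.

Lemma dist_fin_num x S : S !=set0 -> dist x S \is a fin_num.
Proof.
move=> [a Sa]; rewrite ge0_fin_numE.
  exact: le_lt_trans (dist_le_norm _ _ _ Sa) (ltry _).
by apply/ereal_infP => _ [b _ <-]; rewrite lee_fin.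
Qed.

Lemma le_dist_normD x y S : (dist x S <= `|x - y|%:E + dist y S)%E.
Proof.
rewrite -leeBlDl//; apply/ereal_infP => _ [a Sa <-].
rewrite leeBlDl// -EFinD (le_trans (dist_le_norm x _ _ Sa))//.
by rewrite lee_fin; exact: ler_distD.
Qed.

(** By the triangle inequality a step of length [`|x - y|] lowers the distance
    to [S] by at most that length; if [c * dist x S] bounds what is left, then
    at least [(1 - c) * dist x S] was gained. *)
Lemma dist_contract_le_norm x y (S : set E) (c : R) : S !=set0 ->
  (dist y S <= c%:E * dist x S)%E -> ((1 - c)%:E * dist x S <= `|x - y|%:E)%E.
Proof.
move=> S0 contr; have := le_trans (le_dist_normD x y S) (leeD2l _ contr).
(* Cancelling [c * dist x S] is legitimate only for a finite distance. *)
rewrite -(fineK (dist_fin_num x _ S0)) -!EFinM -EFinD !lee_fin.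
by rewrite mulrBl mul1r lerBlDr.
Qed.

End Distance.

Section Generated.
Context {R : realType} {E : euclideanType R}.
Implicit Types (T : E -> set E) (x y : E).

Lemma inv_image_minus_id0 T : inv_image (minus_id T) 0 = Fix T.
Proof.
apply/seteqP; split=> x /=; last by exists x => //; rewrite subrr.
by move=> [y Txy /eqP]; rewrite subr_eq0 => /eqP yx; rewrite yx in Txy.
Qed.

Lemma generated_by_extend T x y : (forall z, T z !=set0) -> T x y ->
  exists u : nat -> E, [/\ u 0%N = x, u 1%N = y & generated_by T u].
Proof.
move=> /choice[f Tf] Txy.
exists (fun n => if n is m.+1 then iter m f y else x); split=> // -[|k] //=.
Qed.

End Generated.

Theorem theorem3p12 (R : realType) (E : euclideanType R)
    (T : E -> set E) (Lambda Omega : set E) (c : R)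
    (T_nonempty : forall x : E, T x !=set0)
    (FixT_nonempty : Fix T !=set0)
    (FixTLambda_closed : closed (Fix T `&` Lambda))
    (FixTLambda_nonempty : Fix T `&` Lambda !=set0)
    (Omega_sub : Omega `<=` Lambda)
    (c_ge0 : 0 <= c) (c_lt1 : c < 1)
    (monotone : forall x0 : E, Omega x0 ->
      forall u : nat -> E, u 0%N = x0 -> generated_by T u ->
        (forall k : nat, T (u k) `<=` Lambda) /\
        linearly_monotone u (Fix T `&` Lambda) c) :
  exists kappa : R,
    [/\ 0 < kappa, kappa <= 1 / (1 - c) &
        metrically_subregular (minus_id T) Omega 0 Lambda kappa].
Proof.
exists (1 - c)^-1; split.
- by rewrite invr_gt0 subr_gt0.
- by rewrite div1r.
- move=> x [Ox _]; rewrite inv_image_minus_id0 lee_pdivlMl ?subr_gt0//.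
  apply/ereal_infP => _ [_ [y Txy <-] <-]; rewrite sub0r opprB.
  apply: dist_contract_le_norm FixTLambda_nonempty _.
  have [u [u0 u1 genu]] := generated_by_extend _ _ _ T_nonempty Txy.
  by have [_ /(_ 0%N)] := monotone x Ox u u0 genu; rewrite u0 u1.
Qed.
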